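(* Let $k$ be a field, $G=\mathrm{GL}_2^3$, and let $V$ be either (a) $\mathbb{A}^2\otimes\mathbb{A}^2\otimes\mathbb{A}^2\oplus\mathbb{A}^2$ or (b) $\mathbb{A}^2\otimes\mathbb{A}^2\otimes\mathbb{A}^2\oplus\mathbb{A}^2\oplus\mathbb{A}^2$, with the action and the polynomials $P_1,P_2$ (and $P_3$ in case (b)) described in the context. Let $U=\{x\in V_k\mid P_1(x),P_2(x)\neq0\}$ in case (a) and $U=\{x\in V_k\mid P_1(x),P_2(x),P_3(x)\neq0\}$ in case (b). Then in both cases the map $V\ni x\mapsto(A(x),B(x))\in\mathbb{A}^2\otimes\mathbb{A}^2\otimes\mathbb{A}^2$ induces a bijection $$G_k\backslash U\to\mathrm{GL}_2(k)^3\backslash(k^2\otimes k^2\otimes k^2)^{\mathrm{ss}}\cong\mathrm{Ex}_2(k).$$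
   Context: $\mathrm{Ex}_2(k)$ is the set of conjugacy classes of homomorphisms $\mathrm{Gal}(k^{\mathrm{sep}}/k)\to\mathfrak{S}_2$, i.e. the set of $k$-isomorphism classes of separable extensions of $k$ of degree at most $2$. $\mathbb{A}^2\otimes\mathbb{A}^2\otimes\mathbb{A}^2$ is identified with the space of pairs of $2\times2$ matrices. Elements of $V$ are written $x=(A(x),B(x),v(x))$ in case (a) and $x=(A(x),B(x),v_1(x),v_2(x))$ in case (b), with $A(x),B(x)$ $2\times2$ matrices and $v(x),v_1(x),v_2(x)$ column vectors in $\mathbb{A}^2$. For $g=(g_1,g_2,g_3)$ with $g_3=\begin{pmatrix}\alpha&\beta\\\gamma&\delta\end{pmatrix}$, (a) $gx=(\alpha g_1A\,{}^tg_2+\beta g_1B\,{}^tg_2,\ \gamma g_1A\,{}^tg_2+\delta g_1B\,{}^tg_2,\ g_1v)$, (b) $gx=(\alpha g_1A\,{}^tg_2+\beta g_1B\,{}^tg_2,\ \gamma g_1A\,{}^tg_2+\delta g_1B\,{}^tg_2,\ g_1v_1,\ g_2v_2)$. $P_1(x)$ is the discriminant of the binary quadratic form $F(s_1,s_2)=\det(s_1A(x)+s_2B(x))$. $(k^2\otimes k^2\otimes k^2)^{\mathrm{ss}}$ is the set of pairs $(A,B)$ with this discriminant non-zero, with the action of $\mathrm{GL}_2(k)^3$ given by the same formula, and the bijection of its orbits with $\mathrm{Ex}_2(k)$ associates to $(A,B)$ the field generated by the roots of $F$. For $v=[a,b]\in\mathbb{A}^2$ put $\tilde v=[b,-a]$.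 $P_2(x)$ is the determinant of the $2\times2$ matrix with rows ${}^t\tilde vA(x)$, ${}^t\tilde vB(x)$, where $v=v(x)$ in case (a) and $v=v_1(x)$ in case (b). In case (b), $P_3(x)$ is the determinant of the $2\times2$ matrix with columns $A(x)\tilde v_2$, $B(x)\tilde v_2$, where $\tilde v_2$ is formed from $v_2(x)$. (These are the determinants of the elements of $\mathbb{A}^2\otimes\mathbb{A}^2$ obtained by pairing the first, resp. second, $\mathbb{A}^2$ factor with the vector via $\wedge^2\mathbb{A}^2\cong\mathbb{A}^1$.) *)

(* Defs.v *)
From HB Require Import structures.
From mathcomp Require Export all_boot all_order all_algebra all_field.
From mathcomp Require Export boolp classical_sets functions.

Set Implicit Arguments.
Unset Strict Implicit.
Unset Printing Implicit Defensive.

Import GRing.Theory.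
Local Open Scope classical_set_scope.
Local Open Scope ring_scope.

Definition triples (k : fieldType) : Type := 'M[k]_2 * 'M[k]_2 * 'M[k]_2.

(* The k-points of GL_2^3; MathComp's own GL_n notation is for finite rings. *)
Definition GL2_3 (k : fieldType) : set (triples k) :=
  [set g | [/\ g.1.1 \in unitmx, g.1.2 \in unitmx & g.2 \in unitmx]].

Definition orbit_of (k : fieldType) (T : Type) (act : triples k -> T -> T)
    (x : T) : set T :=
  [set act g x | g in @GL2_3 k].

(* The quotient by GL_2(k)^3 of an invariant subset S, as a set of orbits. *)
Definition orbit_space (k : fieldType) (T : Type) (act : triples k -> T -> T)
    (S : set T) : set (set T) :=
  [set orbit_of act x | x in S].

(* k^2 (x) k^2 (x) k^2 as pairs (A, B); cases (a) and (b) then read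
   ((A, B), v) and (((A, B), v1), v2). *)
Definition pairs (k : fieldType) : Type := 'M[k]_2 * 'M[k]_2.
Definition Va (k : fieldType) : Type := pairs k * 'cV[k]_2.
Definition Vb (k : fieldType) : Type := pairs k * 'cV[k]_2 * 'cV[k]_2.

Definition act_pairs (k : fieldType) (g : triples k) (w : pairs k) : pairs k :=
  let: (g1, g2, g3) := g in
  let: (A, B) := w in
  (g3 0 0 *: (g1 *m A *m g2^T) + g3 0 1 *: (g1 *m B *m g2^T),
   g3 1 0 *: (g1 *m A *m g2^T) + g3 1 1 *: (g1 *m B *m g2^T)).

Definition act_a (k : fieldType) (g : triples k) (x : Va k) : Va k :=
  let: (w, v) := x in (act_pairs g w, g.1.1 *m v).

Definition act_b (k : fieldType) (g : triples k) (x : Vb k) : Vb k :=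
  let: (w, v1, v2) := x in (act_pairs g w, g.1.1 *m v1, g.1.2 *m v2).

Definition proj_a (k : fieldType) (x : Va k) : pairs k := x.1.
Definition proj_b (k : fieldType) (x : Vb k) : pairs k := x.1.1.

Definition form (R : comNzRingType) (A B : 'M[R]_2) (s1 s2 : R) : R :=
  \det (s1 *: A + s2 *: B).

(* F('X, 1): its coefficients of degree 2, 1, 0 are those of s1^2, s1 s2, s2^2
   in F. *)
Definition form_poly (k : fieldType) (w : pairs k) : {poly k} :=
  form (map_mx polyC w.1) (map_mx polyC w.2) 'X 1.

Definition P1 (k : fieldType) (w : pairs k) : k :=
  let p := form_poly w in p`_1 ^+ 2 - 4%:R * p`_2 * p`_0.

Definition pairs_ss (k : fieldType) : set (pairs k) := [set w | P1 w != 0].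

Definition tilde (k : fieldType) (v : 'cV[k]_2) : 'cV[k]_2 :=
  \col_i (if i == 0 then v 1 0 else - v 0 0).

Definition P2 (k : fieldType) (w : pairs k) (v : 'cV[k]_2) : k :=
  \det (col_mx ((tilde v)^T *m w.1) ((tilde v)^T *m w.2)).

Definition P3 (k : fieldType) (w : pairs k) (v : 'cV[k]_2) : k :=
  \det (row_mx (w.1 *m tilde v) (w.2 *m tilde v)).

Definition Ua (k : fieldType) : set (Va k) :=
  [set x | P1 x.1 != 0 /\ P2 x.1 x.2 != 0].

Definition Ub (k : fieldType) : set (Vb k) :=
  [set x | [/\ P1 x.1.1 != 0, P2 x.1.1 x.1.2 != 0 & P3 x.1.1 x.2 != 0]].

(* Classes of extensions are plain predicates: [set (fieldExtType k)] is a
   universe inconsistency, [set] living in too small a universe. *)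
Definition ext_class (k : fieldType) : Type := fieldExtType k -> Prop.

Definition ext_iso (k : fieldType) (L L' : fieldExtType k) : Prop :=
  exists f : {lrmorphism L -> L'}, bijective f.

Definition Ex2 (k : fieldType) (C : ext_class k) : Prop :=
  exists L : fieldExtType k,
    [/\ separable 1 {:L}, (\dim {:L} <= 2)%N & C = ext_iso L].

(* L is generated over k by the roots of F, for F of nonzero discriminant: such
   an F has exactly two roots [p.1 : p.2] and [q.1 : q.2] in P^1. Since x / 0 = 0,
   the root at infinity [1 : 0] adds nothing to the field, as it should. *)
Definition generated_by_roots (k : fieldType) (w : pairs k)
    (L : fieldExtType k) : Prop :=
  let F := form (map_mx (in_alg L) w.1) (map_mx (in_alg L) w.2) in
  exists p q : L * L,
    [/\ p.1 * q.2 - p.2 * q.1 != 0, F p.1 p.2 = 0, F q.1 q.2 = 0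
      & <<1 & [:: p.1 / p.2; q.1 / q.2]>>%VS = {:L}%VS].

Definition root_field_class (k : fieldType) (O : set (pairs k)) : ext_class k :=
  fun L => exists2 w, O w & generated_by_roots w L.

(* [set_bij] for a target in the universe of [ext_class]. *)
Definition bij_onto (T U : Type) (A : T -> Prop) (B : U -> Prop) (f : T -> U) :
    Prop :=
  [/\ forall x, A x -> B (f x),
      forall x y, A x -> A y -> f x = f y -> x = y
    & forall y, B y -> exists2 x, A x & f x = y].

(* Main.v *)
(** Every pair (A, B) of nonzero discriminant is equivalent to (1, C) with C a
companion matrix. If t and s are units of k[C], then (t, tr s, g3) fixes (1, C)
for a suitable g3, because g3 can realize multiplication by (t s)^-1 on the
basis (1, C) of k[C]. A vector v with P2 <> 0 is one that is cyclic for C, i.e. a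
generator of k^2 as a k[C]-module (and P3 <> 0 means cyclic for tr C), so the
stabilizer of (1, C) permutes transitively the admissible vectors, even pairs of
them. This gives (a) and (b). For (1, C) the root field is k[x] with
x^2 + a x + b = 0, where X^2 - a X + b is the characteristic polynomial of C; if
k[x] = k[x'], then an affine substitution x' = u + v x (or the one matching the
two pairs of roots, when they lie in k) carries C to C'. *)

From HB Require Import structures.
Require Import Defs.
From mathcomp Require Import ring.

Set Implicit Arguments.
Unset Strict Implicit.
Unset Printing Implicit Defensive.

Import GRing.Theory.
Local Open Scope ring_scope.
Local Open Scope classical_set_scope.

(** * Matrices of size two and the coefficients of F *)

Lemma ord2P (i : 'I_2) : {i = 0} + {i = 1}.
Proof. by case: i => [[|[|//]] ?]; [left|right]; apply/val_inj. Qed.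

Lemma eq_mx22 (R : Type) (A B : 'M[R]_2) :
  A 0 0 = B 0 0 -> A 0 1 = B 0 1 -> A 1 0 = B 1 0 -> A 1 1 = B 1 1 -> A = B.
Proof.
move=> h00 h01 h10 h11; apply/matrixP => i j.
by case: (ord2P i) => ->; case: (ord2P j) => ->.
Qed.

Lemma eq_cV2 (R : Type) (u v : 'cV[R]_2) : u 0 0 = v 0 0 -> u 1 0 = v 1 0 -> u = v.
Proof.
by move=> h0 h1; apply/matrixP => i j; rewrite [j]ord1; case: (ord2P i) => ->.
Qed.

Lemma mulmx2E (R : pzSemiRingType) m n (A : 'M[R]_(m, 2)) (B : 'M[R]_(2, n)) i j :
  (A *m B) i j = A i 0 * B 0 j + A i 1 * B 1 j.
Proof.
rewrite mxE !big_ord_recl big_ord0 addr0.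
by rewrite (_ : lift ord0 ord0 = 1) //; apply/val_inj.
Qed.

Lemma det_mx22 (R : comPzRingType) (A : 'M[R]_2) :
  \det A = A 0 0 * A 1 1 - A 0 1 * A 1 0.
Proof.
rewrite (expand_det_row _ 0) !big_ord_recl big_ord0 addr0.
rewrite (_ : lift ord0 ord0 = 1); last exact/val_inj.
rewrite /cofactor !det_mx11 !mxE /= expr0 expr1 mul1r mulN1r mulrN.
by congr (_ * A _ _ - _ * A _ _); apply/val_inj.
Qed.

Lemma col_mx11E (R : Type) n (u v : 'rV[R]_n) j :
  (col_mx u v (0 : 'I_(1 + 1)) j = u 0 j) * (col_mx u v (1 : 'I_(1 + 1)) j = v 0 j).
Proof.
split; first by rewrite -(col_mxEu u v); congr (col_mx u v _ j); apply/val_inj.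
by rewrite -(col_mxEd u v); congr (col_mx u v _ j); apply/val_inj.
Qed.

Lemma tilde0 (k : fieldType) (v : 'cV[k]_2) : tilde v 0 0 = v 1 0.
Proof. by rewrite mxE. Qed.

Lemma tilde1 (k : fieldType) (v : 'cV[k]_2) : tilde v 1 0 = - v 0 0.
Proof. by rewrite mxE. Qed.

(** The characteristic polynomial is X^2 - a X + b, so the pair (1, [companion a b]) has F = s^2 + a
    s t + b t^2, whose roots s/t are the negatives of the eigenvalues. *)
Definition companion (R : pzRingType) (a b : R) : 'M[R]_2 :=
  \matrix_(i, j) if i == 0 then (if j == 0 then 0 else - b)
                 else (if j == 0 then 1 else a).

Definition mx22 (R : Type) (a b c d : R) : 'M[R]_2 :=
  \matrix_(i, j) if i == 0 then (if j == 0 then a else b)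
                 else (if j == 0 then c else d).

Definition mx2E := (mulmx2E, det_mx22, tilde0, tilde1, mxE).

(** The polarization det (A + B) - det A - det B of the determinant. *)
Definition polar_det (R : comNzRingType) (A B : 'M[R]_2) : R :=
  A 0 0 * B 1 1 + A 1 1 * B 0 0 - A 0 1 * B 1 0 - A 1 0 * B 0 1.

Lemma formE (R : comNzRingType) (A B : 'M[R]_2) s t :
  form A B s t = \det A * s ^+ 2 + polar_det A B * (s * t) + \det B * t ^+ 2.
Proof. by rewrite /form /polar_det !mx2E; ring. Qed.

Lemma polar_det_mul (R : comNzRingType) (g h A B : 'M[R]_2) :
  polar_det (g *m A *m h) (g *m B *m h) = \det g * \det h * polar_det A B.
Proof. by rewrite /polar_det !mx2E; ring. Qed.

(** Serves two maps: [polyC], to read off the coefficients of [form_poly], and [in_alg L], to study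
    the roots of F in L. *)
Lemma form_map (R S : comNzRingType) (f : {rmorphism R -> S}) (A B : 'M[R]_2) s t :
  form (map_mx f A) (map_mx f B) s t
  = f (\det A) * s ^+ 2 + f (polar_det A B) * (s * t) + f (\det B) * t ^+ 2.
Proof. by rewrite formE !det_map_mx /polar_det !mxE !(rmorphB, rmorphD, rmorphM). Qed.

Lemma P1E (k : fieldType) (w : pairs k) :
  P1 w = polar_det w.1 w.2 ^+ 2 - 4%:R * \det w.1 * \det w.2.
Proof.
have -> : P1 w = let p := (\det w.1)%:P * 'X^2 + (polar_det w.1 w.2)%:P * 'X
      + (\det w.2)%:P in p`_1 ^+ 2 - 4%:R * p`_2 * p`_0.
  by rewrite /P1 /form_poly form_map mulr1 expr1n mulr1.
rewrite /= !(coefD, coefCM, coefXn, coefX, coefC) /=.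
by rewrite !(mulr0, mulr1, addr0, add0r).
Qed.

(** * The action and its invariants *)

Section Actions.
Variable k : fieldType.
Implicit Types (g h : triples k) (w : pairs k).

Definition mul_triples g h : triples k :=
  (g.1.1 *m h.1.1, g.1.2 *m h.1.2, g.2 *m h.2).

Definition one_triple : triples k := (1%:M, 1%:M, 1%:M).

Definition inv_triple g : triples k := (invmx g.1.1, invmx g.1.2, invmx g.2).

Lemma GL2_3_mul g h : GL2_3 g -> GL2_3 h -> GL2_3 (mul_triples g h).
Proof.
move=> [g1 g2 g3] [h1 h2 h3].
by split; rewrite /= unitmx_mul ?(g1, g2, g3) ?(h1, h2, h3).
Qed.

Lemma GL2_3_inv g : GL2_3 g -> GL2_3 (inv_triple g).
Proof. by move=> [g1 g2 g3]; split; rewrite /= unitmx_inv. Qed.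

Lemma mul_inv_triple g : GL2_3 g -> mul_triples (inv_triple g) g = one_triple.
Proof. by move=> [g1 g2 g3]; rewrite /mul_triples /= !mulVmx. Qed.

(** Packaged so that the same orbit lemmas serve the pairs and both cases (a) and (b). *)
Definition is_act (T : Type) (act : triples k -> T -> T) :=
  (forall x, act one_triple x = x) /\
  (forall g h x, act g (act h x) = act (mul_triples g h) x).

Lemma act_pairs_is_act : is_act (@act_pairs k).
Proof.
split=> [[A B]|[[g1 g2] g3] [[h1 h2] h3] [A B]].
  rewrite /act_pairs /one_triple trmx1 !mul1mx !mulmx1 !mxE /=.
  by rewrite !scale1r !scale0r addr0 add0r.
rewrite /act_pairs /= !trmx_mul !mulmx2E.
set hA := h1 *m A *m h2^T; set hB := h1 *m B *m h2^T.
have E X : g1 *m h1 *m X *m (h2^T *m g2^T) = g1 *m (h1 *m X *m h2^T) *m g2^T.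
  by rewrite !mulmxA.
rewrite !E -/hA -/hB !mulmxDr !mulmxDl -!scalemxAr -!scalemxAl.
rewrite !scalerDr !scalerDl !scalerA.
by congr (_, _); rewrite addrACA.
Qed.

Lemma act_a_is_act : is_act (@act_a k).
Proof.
have [a1 aM] := act_pairs_is_act.
split=> [[w v]|g h [w v]]; rewrite /act_a; first by rewrite a1 mul1mx.
by rewrite aM mulmxA.
Qed.

Lemma act_b_is_act : is_act (@act_b k).
Proof.
have [a1 aM] := act_pairs_is_act.
split=> [[[w v1] v2]|g h [[w v1] v2]]; rewrite /act_b; first by rewrite a1 !mul1mx.
by rewrite aM !mulmxA.
Qed.

Lemma is_actK (T : Type) (act : triples k -> T -> T) g :
  is_act act -> GL2_3 g -> cancel (act g) (act (inv_triple g)).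
Proof. by move=> [a1 aM] gG x; rewrite aM mul_inv_triple. Qed.

Lemma orbit_of_act (T : Type) (act : triples k -> T -> T) g x :
  is_act act -> GL2_3 g -> orbit_of act (act g x) = orbit_of act x.
Proof.
move=> actP gG; apply/seteqP; split=> _ [h hG <-]; have [a1 aM] := actP.
  by exists (mul_triples h g); [exact: GL2_3_mul|rewrite aM].
exists (mul_triples h (inv_triple g)); first exact/GL2_3_mul/GL2_3_inv.
by rewrite -aM is_actK.
Qed.

Lemma orbit_of_refl (T : Type) (act : triples k -> T -> T) x :
  is_act act -> orbit_of act x x.
Proof. by move=> [a1 _]; exists one_triple => //; split; exact: unitmx1. Qed.

(** With J of rows (0, 1) and (-1, 0), [tilde v] is J v, and this is A^T J^T A = (det A) J^T
    multiplied on the left by v^T. *)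
Lemma tilde_mul (A : 'M[k]_2) (v : 'cV[k]_2) :
  (tilde (A *m v))^T *m A = \det A *: (tilde v)^T.
Proof.
by apply/matrixP => i j; rewrite [i]ord1; case: (ord2P j) => ->; rewrite !mx2E; ring.
Qed.

(** The matrix R with the two rows becomes det g1 times g3 R g2^T; a scalar enters a determinant of
    size two squared. *)
Lemma P2_act g w v :
  P2 (act_pairs g w) (g.1.1 *m v)
  = \det g.1.1 ^+ 2 * \det g.1.2 * \det g.2 * P2 w v.
Proof.
case: g w => [[g1 g2] g3] [A B] /=.
have -> : P2 (act_pairs (g1, g2, g3) (A, B)) (g1 *m v) =
  \det (\det g1 *: (g3 *m col_mx ((tilde v)^T *m A) ((tilde v)^T *m B) *m g2^T)).
  rewrite /P2; congr (\det _).
  have E X : (tilde (g1 *m v))^T *m (g1 *m X *m g2^T)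
      = \det g1 *: ((tilde v)^T *m X *m g2^T).
    by rewrite !mulmxA tilde_mul -!scalemxAl.
  rewrite /= !mulmxDr -!scalemxAr !E.
  move: (_ *m A) (_ *m B) => rA rB.
  by apply: eq_mx22; rewrite !(mulmx2E, col_mx11E, mxE); ring.
rewrite detZ !det_mulmx det_tr /P2 /=; ring.
Qed.

End Actions.

Section Equivariance.
Variable k : fieldType.
Implicit Types (g h : triples k) (w : pairs k).

(** Transposing A and B exchanges the first two tensor factors, so facts about [P3] reduce to facts
    about [P2]. *)
Lemma P3_tr w v : P3 w v = P2 (w.1^T, w.2^T) v.
Proof.
have E (x y : 'cV[k]_2) : \det (row_mx x y : 'M_2) = \det (col_mx x^T y^T : 'M_2).
  by rewrite -det_tr; exact: (congr1 (@determinant k 2) (tr_row_mx x y)).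
by rewrite /P3 E !trmx_mul.
Qed.

Lemma P3_act g w v :
  P3 (act_pairs g w) (g.1.2 *m v)
  = \det g.1.2 ^+ 2 * \det g.1.1 * \det g.2 * P3 w v.
Proof.
case: g w => [[g1 g2] g3] [A B]; rewrite !P3_tr -(P2_act (g2, g1, g3)).
congr (P2 _ _); rewrite /act_pairs !linearD !linearZ /=.
by rewrite !trmx_mul !trmxK !mulmxA.
Qed.

(** F is scaled by det g1 det g2 and undergoes a linear substitution of determinant det g3; the
    discriminant picks up the squares of both. *)
Lemma P1_act g w :
  P1 (act_pairs g w) = (\det g.1.1 * \det g.1.2 * \det g.2) ^+ 2 * P1 w.
Proof.
case: g w => [[g1 g2] g3] [A B]; rewrite !P1E /=.
rewrite -!/(form _ _ _ _) !formE.
(* Bilinearity of [polar_det], together with [polar_det X X] = 2 det X. *)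
have E X Y a b c d : polar_det (a *: X + b *: Y) (c *: X + d *: Y) =
    2%:R * a * c * \det X + (a * d + b * c) * polar_det X Y
    + 2%:R * b * d * \det Y :> k.
  by rewrite /polar_det !mx2E; ring.
rewrite E polar_det_mul !det_mulmx det_tr (det_mx22 g3); ring.
Qed.

Lemma P1_act_neq0 g w : GL2_3 g -> (P1 (act_pairs g w) != 0) = (P1 w != 0).
Proof.
move=> [g1 g2 g3]; rewrite P1_act; move: g1 g2 g3; rewrite !unitmxE !unitfE.
by move=> /negPf g1 /negPf g2 /negPf g3; rewrite !(mulf_eq0, expf_eq0) g1 g2 g3.
Qed.

Lemma P2_act_neq0 g w v :
  GL2_3 g -> (P2 (act_pairs g w) (g.1.1 *m v) != 0) = (P2 w v != 0).
Proof.
move=> [g1 g2 g3]; rewrite P2_act; move: g1 g2 g3; rewrite !unitmxE !unitfE.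
by move=> /negPf g1 /negPf g2 /negPf g3; rewrite !(mulf_eq0, expf_eq0) g1 g2 g3.
Qed.

Lemma P3_act_neq0 g w v :
  GL2_3 g -> (P3 (act_pairs g w) (g.1.2 *m v) != 0) = (P3 w v != 0).
Proof.
move=> [g1 g2 g3]; rewrite P3_act; move: g1 g2 g3; rewrite !unitmxE !unitfE.
by move=> /negPf g1 /negPf g2 /negPf g3; rewrite !(mulf_eq0, expf_eq0) g1 g2 g3.
Qed.

(** * Cyclic vectors, stabilizers and the normal form of a pair *)

Definition wedge (R : pzRingType) (u v : 'cV[R]_2) : R :=
  u 0 0 * v 1 0 - u 1 0 * v 0 0.

(** [wedge v (M *m v)] is the determinant with columns v and M v, hence nonzero exactly when v is
    cyclic for M. *)
Lemma P2_1 (M : 'M[k]_2) v : P2 (1%:M, M) v = - wedge v (M *m v).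
Proof. by rewrite /P2 /wedge det_mx22 !(mulmx2E, col_mx11E, mxE) /=; ring. Qed.

Lemma P3_1 (M : 'M[k]_2) v : P3 (1%:M, M) v = - wedge v (M^T *m v).
Proof. by rewrite P3_tr /= trmx1 P2_1. Qed.

(* Cramer's rule gives t = x + y M with t v = v'; since t commutes with M, it
   scales [wedge v (M v)] by [\det t], hence is invertible. *)
Lemma cyclic_transitive (M : 'M[k]_2) (v v' : 'cV[k]_2) :
  wedge v (M *m v) != 0 -> wedge v' (M *m v') != 0 ->
  exists x y, (x%:M + y *: M \in unitmx) /\ (x%:M + y *: M) *m v = v'.
Proof.
move=> vM vM'; set D := wedge v (M *m v) in vM.
pose x := wedge v' (M *m v) / D; pose y := wedge v v' / D.
have E : (x%:M + y *: M) *m v = v'.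
  move: vM; rewrite /x /y /D /wedge !mulmx2E => vM.
  by apply: eq_cV2; rewrite !mx2E /=; field.
exists x, y; split=> //; rewrite unitmxE unitfE; apply: contraNneq vM' => t0.
rewrite -E; suff -> : wedge ((x%:M + y *: M) *m v) (M *m ((x%:M + y *: M) *m v))
   = \det (x%:M + y *: M) * D by rewrite t0 mul0r.
by rewrite /D /wedge !mx2E /=; ring.
Qed.

Lemma stab_pairs (M : 'M[k]_2) x y x' y' :
  x%:M + y *: M \in unitmx -> x'%:M + y' *: M^T \in unitmx ->
  exists (c : 'M[k]_2), GL2_3 (x%:M + y *: M, x'%:M + y' *: M^T, c) /\
    act_pairs (x%:M + y *: M, x'%:M + y' *: M^T, c) (1%:M, M) = (1%:M, M).
Proof.
move=> tU sU; set t := x%:M + _ in tU *; set s := x'%:M + _ in sU *.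
pose tau := M 0 0 + M 1 1; pose d := \det M.
pose p := x * x' - y * y' * d; pose q := x * y' + y * x' + y * y' * tau.
pose D := p ^+ 2 + p * q * tau + q ^+ 2 * d.
(* t s^T = p + q M has determinant D and inverse (p + q tau - q M) / D, whose
   multiplication matrix on the basis (1, M) is the required c. *)
have D0 : D != 0.
  suff -> : D = \det t * \det s.
    by rewrite mulf_neq0 // -unitfE -unitmxE.
  by rewrite /D /p /q /tau /d /t /s !mx2E /=; ring.
have T1 : t *m 1%:M *m s^T = p%:M + q *: M.
  by apply: eq_mx22; rewrite /p /q /tau /d /t /s !mx2E /=; ring.
(* This is M (p + q M), reduced by Cayley-Hamilton: M^2 = tau M - d. *)
have TM : t *m M *m s^T = (- (q * d))%:M + (p + q * tau) *: M.
  by apply: eq_mx22; rewrite /p /q /tau /d /t /s !mx2E /=; ring.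
exists (mx22 ((p + q * tau) / D) (- q / D) (q * d / D) (p / D)).
move: D0 T1 TM; rewrite {}/D; clearbody p q tau d => D0 T1 TM; split.
  split=> //=; rewrite unitmxE unitfE !mx2E /=.
  (* The witness has determinant 1 / D, so its vanishing would give 1 = D * 0. The fact D != 0 is
     reintroduced because [field] divides by D. *)
  apply: contraNneq D0 => E; apply: contraT => D0.
  suff : (1 : k) = 0 by move/eqP; rewrite oner_eq0.
  rewrite -[RHS](mulr0 (p ^+ 2 + p * q * tau + q ^+ 2 * d)) -E.
  by field.
rewrite /act_pairs T1 TM.
by congr (_, _); apply: eq_mx22; rewrite !mx2E /=; field.
Qed.

(* The three points (1, 0), (0, 1), (1, 1) suffice, even over F_2: a quadratic
   form vanishing at the first two is a multiple of s1 s2. *)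
Lemma det_neq0_pencil w : P1 w != 0 ->
  exists2 g : triples k, GL2_3 g & \det (act_pairs g w).1 != 0.
Proof.
case: w => A B w_ss.
have gU (c : 'M[k]_2) : \det c != 0 -> @GL2_3 k (1%:M, 1%:M, c).
  by move=> c0; split; rewrite /= ?unitmx1 // unitmxE unitfE.
have E a b c d : \det (act_pairs (1%:M, 1%:M, mx22 a b c d) (A, B)).1 = form A B a b.
  by rewrite /= trmx1 !mul1mx !mulmx1 !mxE.
have [A0|A0] := boolP (\det A == 0); last first.
  exists (1%:M, 1%:M, mx22 1 0 0 1).
    by apply: gU; rewrite !mx2E /= mulr1 mul0r subr0 oner_eq0.
  by rewrite E formE expr1n expr0n /= !(mulr0, mulr1, addr0).
have [B0|B0] := boolP (\det B == 0); last first.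
  exists (1%:M, 1%:M, mx22 0 1 1 0).
    by apply: gU; rewrite !mx2E /= mulr0 mul1r sub0r oppr_eq0 oner_eq0.
  by rewrite E formE expr1n expr0n /= !(mulr0, mul0r, mulr1, add0r).
exists (1%:M, 1%:M, mx22 1 1 0 1).
  by apply: gU; rewrite !mx2E /= mulr1 mulr0 subr0 oner_eq0.
move: w_ss; rewrite E formE P1E /= (eqP A0) (eqP B0) !(mulr0, mul0r, addr0, subr0, add0r) mulr1.
by rewrite mulr1 expf_eq0.
Qed.

(** The quadratic form v -> [wedge v (M *m v)] is tested at (1, 0), (0, 1) and (1, 1). If it
    vanishes at the first two, M is diagonal and P1 is the square of its value at the third. *)
Lemma exists_cyclic (M : 'M[k]_2) : P1 (1%:M, M) != 0 ->
  exists v, wedge v (M *m v) != 0.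
Proof.
move=> M_ss; pose e (a b : k) : 'cV[k]_2 := \col_i if i == 0 then a else b.
have E a b : wedge (e a b) (M *m e a b)
    = a ^+ 2 * M 1 0 + a * b * (M 1 1 - M 0 0) - b ^+ 2 * M 0 1.
  by rewrite /wedge !mx2E /=; ring.
have [M10|M10] := boolP (M 1 0 == 0); last first.
  by exists (e 1 0); rewrite E; move: M10; congr (_ != 0); ring.
have [M01|M01] := boolP (M 0 1 == 0); last first.
  by exists (e 0 1); rewrite E -oppr_eq0; move: M01; congr (_ != 0); ring.
exists (e 1 1); rewrite E (eqP M10) (eqP M01); apply: contraNneq M_ss => H.
suff -> : P1 (1%:M, M) = (1 ^+ 2 * 0 + 1 * 1 * (M 1 1 - M 0 0) - 1 ^+ 2 * 0) ^+ 2.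
  by rewrite H expr0n.
by rewrite P1E /polar_det /= !mx2E /= (eqP M10) (eqP M01); ring.
Qed.

Lemma P1_companion (a b : k) : P1 (1%:M, companion a b) = a ^+ 2 - 4%:R * b.
Proof. by rewrite P1E /polar_det /= !mx2E /=; ring. Qed.

(** First A is made invertible by the third factor, then it is turned into 1 by A^-1, and finally M
    = A^-1 B is written in the basis (v, M v) of a cyclic vector v. *)
Lemma normal_form w : P1 w != 0 -> exists g a b,
  [/\ GL2_3 g, act_pairs g w = (1%:M, companion a b) & a ^+ 2 - 4%:R * b != 0].
Proof.
move=> w_ss; have [a1 aM] := act_pairs_is_act k.
have [g gG] := det_neq0_pencil w_ss.
case Ew: (act_pairs g w) => [A B] /= detA.
have AU : A \in unitmx by rewrite unitmxE unitfE.
pose h : triples k := (invmx A, 1%:M, 1%:M).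
have hG : GL2_3 h by split; rewrite /= ?unitmx1 // unitmx_inv.
pose M := invmx A *m B.
have Eh : act_pairs h (A, B) = (1%:M, M).
  by rewrite /= trmx1 !mulmx1 mulVmx // !mxE /= !scale1r !scale0r addr0 add0r.
have M_ss : P1 (1%:M, M) != 0 by rewrite -Eh P1_act_neq0 // -Ew P1_act_neq0.
have [v v_cyc] := exists_cyclic M_ss.
pose c : 'M[k]_2 := \matrix_(i, j) if j == 0 then v i 0 else (M *m v) i 0.
have cU : c \in unitmx.
  rewrite unitmxE unitfE; move: v_cyc; congr (_ != 0).
  by rewrite /wedge det_mx22 !mxE /=; ring.
pose a := M 0 0 + M 1 1; pose b := \det M.
have Mc : M *m c = c *m companion a b.
  by apply: eq_mx22; rewrite /a /b !mx2E /=; ring.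
(* As g2 acts through its transpose, this triple acts by conjugation by c, which fixes 1. *)
pose l : triples k := (invmx c, c^T, 1%:M).
have lG : GL2_3 l by split; rewrite /= ?unitmx1 ?unitmx_tr // unitmx_inv.
have El : act_pairs l (1%:M, M) = (1%:M, companion a b).
  rewrite /= trmxK !mulmx1 mulVmx // -mulmxA Mc mulmxA mulVmx // mul1mx.
  by rewrite !mxE /= !scale1r !scale0r addr0 add0r.
exists (mul_triples l (mul_triples h g)), a, b; split.
- exact/GL2_3_mul/GL2_3_mul.
- by rewrite -!aM Ew Eh El.
- by rewrite -P1_companion -El P1_act_neq0.
Qed.

End Equivariance.

(** * Cases (a) and (b) *)

Section Vectors.
Variable k : fieldType.
Implicit Types (g h : triples k) (w : pairs k).

Lemma Ub_act g (x : Vb k) : GL2_3 g -> Ub x -> Ub (act_b g x).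
Proof.
case: x => [[w v1] v2] gG [/= w0 w1 w2].
by split; [rewrite (P1_act_neq0 _ gG)|rewrite (P2_act_neq0 _ _ gG)
          |rewrite (P3_act_neq0 _ _ gG)].
Qed.

Lemma Ua_act g (x : Va k) : GL2_3 g -> Ua x -> Ua (act_a g x).
Proof.
case: x => [w v] gG [/= w0 w1].
by split; [rewrite (P1_act_neq0 _ gG)|rewrite (P2_act_neq0 _ _ gG)].
Qed.

(** The stabilizer of w is the conjugate by g of that of the normal form, where the elements moving
    v1 and v2 are found independently and the third component restores the pair. *)
Lemma Ub_fiber_transitive (x y : Vb k) : Ub x -> Ub y -> proj_b x = proj_b y ->
  exists2 g, GL2_3 g & act_b g x = y.
Proof.
move=> xU yU exy; have [a1 aM] := act_b_is_act k.
have [w_ss _ _] := xU; have [g [a [b [gG gw _]]]] := normal_form w_ss.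
have := Ub_act gG xU; have := Ub_act gG yU.
case: x y xU yU exy w_ss gw => [[w v1] v2] [[w' v1'] v2'] /= xU yU.
rewrite /proj_b /= => ew; rewrite -{}ew {w'} in yU *; move=> _ gw.
rewrite /act_b gw => -[_ /= y1 y2] [_ /= x1 x2].
move: x1 x2 y1 y2; rewrite !P2_1 !P3_1 !oppr_eq0 => x1 x2 y1 y2.
have [s [s' [sU sv]]] := cyclic_transitive x1 y1.
have [t [t' [tU tv]]] := cyclic_transitive x2 y2.
have [c [hG hw]] := stab_pairs sU tU; set h : triples k := (_, _, _) in hG hw.
exists (mul_triples (inv_triple g) (mul_triples h g)).
  exact/GL2_3_mul/GL2_3_mul/gG/hG/GL2_3_inv.
change (act_b (mul_triples (inv_triple g) (mul_triples h g)) (w, v1, v2)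
  = (w, v1', v2')).
rewrite -!aM -[RHS](is_actK (act_b_is_act k) gG); congr act_b.
by rewrite /act_b gw hw sv tv.
Qed.

Lemma exists_P2_P3 w : P1 w != 0 -> exists v1 v2, P2 w v1 != 0 /\ P3 w v2 != 0.
Proof.
move=> w_ss; have [g [a [b [gG gw _]]]] := normal_form w_ss.
have gG' := GL2_3_inv gG.
have -> : w = act_pairs (inv_triple g) (1%:M, companion a b).
  by rewrite -gw is_actK //; exact: act_pairs_is_act.
pose e (i : 'I_2) : 'cV[k]_2 := delta_mx i 0.
(* In normal form C e_0 = e_1, so e_0 is cyclic for C, and e_1 is cyclic for its transpose. *)
exists ((inv_triple g).1.1 *m e 0), ((inv_triple g).1.2 *m e 1).
rewrite (P2_act_neq0 _ _ gG') (P3_act_neq0 _ _ gG') P2_1 P3_1 !oppr_eq0 /wedge !mx2E /=.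
rewrite !(mulr0, mulr1, mul0r, mul1r, addr0, add0r, subr0, sub0r) ?oppr_eq0.
by rewrite oner_eq0.
Qed.

(** Both points are completed by the same auxiliary second vector u, which reduces the claim to case
    (b). *)
Lemma Ua_fiber_transitive (x y : Va k) : Ua x -> Ua y -> proj_a x = proj_a y ->
  exists2 g, GL2_3 g & act_a g x = y.
Proof.
case: x y => [w v] [w' v'] [/= w_ss xU] [/= _ yU]; rewrite /proj_a /= => ew.
rewrite -{}ew {w'} in yU *; have [_ [u [_ u0]]] := exists_P2_P3 w_ss.
have [g gG] := @Ub_fiber_transitive (w, v, u) (w, v', u)
  (And3 w_ss xU u0) (And3 w_ss yU u0) erefl.
by rewrite /act_b /act_a => -[gw gv _]; exists g => //; rewrite gw gv.
Qed.

(** For injectivity, some g moves x into the fibre of y, and transitivity on that fibre finishes. *)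
Lemma set_bij_orbits (T : Type) (act : triples k -> T -> T) (U : set T)
    (proj : T -> pairs k) :
  is_act act -> (forall g x, proj (act g x) = act_pairs g (proj x)) ->
  (forall g x, GL2_3 g -> U x -> U (act g x)) ->
  set_surj U (@pairs_ss k) proj -> set_fun U (@pairs_ss k) proj ->
  (forall x y, U x -> U y -> proj x = proj y -> exists2 g, GL2_3 g & act g x = y) ->
  set_bij (orbit_space act U) (orbit_space (@act_pairs k) (@pairs_ss k))
    (fun O => proj @` O).
Proof.
move=> actP projM U_act proj_surj proj_fun fiber.
have E x : proj @` orbit_of act x = orbit_of (@act_pairs k) (proj x).
  apply/seteqP; split=> [_ [_ [g gG <-] <-]|_ [g gG <-]].
    by exists g => //; rewrite projM.
  by exists (act g x); [exists g|rewrite projM].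
split=> [_ [x xU <-]|O O'|_ [w /proj_surj [x xU <-] <-]].
- by rewrite E; exists (proj x) => //; exact: proj_fun.
- rewrite !inE => -[x xU <-] [y yU <-]; rewrite !E => exy.
  have [g gG gx] : orbit_of (@act_pairs k) (proj x) (proj y).
    by rewrite exy; exact/orbit_of_refl/act_pairs_is_act.
  rewrite -(orbit_of_act x actP gG).
  have [|h hG <-] := fiber (act g x) y (U_act _ _ gG xU) yU; first by rewrite projM.
  by rewrite (orbit_of_act (act g x) actP hG).
- by exists (orbit_of act x); [exists x|rewrite E].
Qed.

Lemma bij_a : set_bij (orbit_space (@act_a k) (@Ua k))
  (orbit_space (@act_pairs k) (@pairs_ss k)) (fun O => @proj_a k @` O).
Proof.
apply: set_bij_orbits.
- exact: act_a_is_act.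
- by move=> g [].
- exact: Ua_act.
- by move=> w w_ss; have [v [_ [v0 _]]] := exists_P2_P3 w_ss; exists (w, v).
- by move=> x [].
- exact: Ua_fiber_transitive.
Qed.

Lemma bij_b : set_bij (orbit_space (@act_b k) (@Ub k))
  (orbit_space (@act_pairs k) (@pairs_ss k)) (fun O => @proj_b k @` O).
Proof.
apply: set_bij_orbits.
- exact: act_b_is_act.
- by move=> g [[]].
- exact: Ub_act.
- by move=> w w_ss; have [v [u [v0 u0]]] := exists_P2_P3 w_ss; exists (w, v, u).
- by move=> x [].
- exact: Ub_fiber_transitive.
Qed.

End Vectors.

(** * Quadratic extensions *)

Section MonogenicExtensions.
Variable k : fieldType.
Implicit Types (L : fieldExtType k) (a b : k).

(** Phrased with polynomials rather than subfields so that it passes through morphisms directly. *)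
Definition generates L (x : L) := forall y, exists q : {poly k}, horner_alg x q = y.

Lemma generatesP L (x : L) : <<1; x>>%VS = {:L}%VS <-> generates x.
Proof.
split=> [full y|gen]; last first.
  apply/eqP; rewrite eqEsubv subvf /=; apply/subvP => y _.
  have [q <-] := gen y; apply/Fadjoin_polyP; exists (map_poly (in_alg L) q) => //.
  by apply/polyOver1P; exists q.
have : y \in <<1; x>>%VS by rewrite full memvf.
by case/Fadjoin_polyP => _ /polyOver1P [q ->] ->; exists q.
Qed.

(** Both fields are the quotient of k[X] by the same kernel. The map sends q(x) to q(x') for a
    chosen q; [ker2] makes the choice immaterial. *)
Lemma ext_iso_of_kernel L L' (x : L) (x' : L') : generates x -> generates x' ->
  (forall q : {poly k}, horner_alg x q = 0 <-> horner_alg x' q = 0) -> ext_iso L L'.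
Proof.
move=> gx gx' ker.
have ker2 p q : horner_alg x p = horner_alg x q <-> horner_alg x' p = horner_alg x' q.
  by split=> /eqP; rewrite -subr_eq0 -rmorphB => /eqP/ker/eqP;
    rewrite rmorphB subr_eq0 => /eqP.
pose f y := horner_alg x' (projT1 (cid (gx y))).
have fE q : f (horner_alg x q) = horner_alg x' q.
  by apply/ker2; rewrite /f; case: cid.
have fD : zmod_morphism f.
  move=> y z; have [p <-] := gx y; have [q <-] := gx z.
  by rewrite -rmorphB !fE rmorphB.
have fM : monoid_morphism f.
  split=> [|y z]; first by rewrite -(rmorph1 (horner_alg x)) fE rmorph1.
  have [p <-] := gx y; have [q <-] := gx z.
  by rewrite -rmorphM !fE rmorphM.
have fZ : scalable f.
  move=> c y; have [p <-] := gx y.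
  rewrite -mulr_algl -(horner_algC x) -rmorphM !fE rmorphM.
  by rewrite /= horner_algC mulr_algl.
pose F : {lrmorphism L -> L'} := HB.pack f (GRing.isZmodMorphism.Build L L' f fD)
  (GRing.isMonoidMorphism.Build L L' f fM) (GRing.isScalable.Build k L L' *:%R f fZ).
exists F.
have gy y : exists y', f y' = y.
  by have [q <-] := gx' y; exists (horner_alg x q); rewrite fE.
exists (fun y => projT1 (cid (gy y))) => y; last by case: cid.
by apply: (fmorph_inj F); case: cid.
Qed.

Lemma horner_alg_lrmorph L L' (f : {lrmorphism L -> L'}) (x : L) (q : {poly k}) :
  horner_alg (f x) q = f (horner_alg x q).
Proof.
change ((map_poly (in_alg L') q).[f x] = f (map_poly (in_alg L) q).[x]).
rewrite -horner_map -map_poly_comp; congr (_.[_]).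
by apply: eq_map_poly => c; rewrite /= rmorph_alg.
Qed.

Lemma generates_iso L L' (f : {lrmorphism L -> L'}) (x : L) :
  bijective f -> generates x -> generates (f x).
Proof.
move=> [g _ gK] gx y; have [q qE] := gx (g y); exists q.
by rewrite horner_alg_lrmorph qE.
Qed.

End MonogenicExtensions.

(** * Extensions generated by a root of a monic quadratic polynomial *)

Section Quadratic.
Variable k : fieldType.
Implicit Types (L : fieldExtType k) (a b r : k).

Definition quad a b : {poly k} := 'X^2 + a%:P * 'X + b%:P.

(** The polynomial may split over k; then x is a scalar and L is k itself. *)
Definition quad_gen L a b (x : L) :=
  generates x /\ x ^+ 2 + a%:A * x + b%:A = 0.

Lemma size_quad a b : size (quad a b) = 3.
Proof.
rewrite /quad -addrA size_polyDl size_polyXn // (leq_ltn_trans (size_polyD _ _)) //.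
rewrite gtn_max mul_polyC (leq_ltn_trans (size_scale_leq _ _)) ?size_polyX //.
by rewrite size_polyC; case: (b != 0).
Qed.

Lemma horner_quad L a b (x : L) :
  horner_alg x (quad a b) = x ^+ 2 + a%:A * x + b%:A.
Proof. by rewrite /quad !rmorphD rmorphXn rmorphM /= !horner_algC !horner_algX. Qed.

Lemma horner_alg_in_alg L r (q : {poly k}) :
  horner_alg (r%:A : L) q = (q.[r])%:A.
Proof. by rewrite -[RHS](horner_map (in_alg L)). Qed.

Lemma quad_factor L a b (x y : L) :
  x ^+ 2 + a%:A * x + b%:A = 0 -> y ^+ 2 + a%:A * y + b%:A = 0 ->
  y = x \/ y = - a%:A - x.
Proof.
move=> xr yr; have : (y - x) * (y + x + a%:A) = 0.
  by rewrite -[RHS](subrr 0) -{1}yr -xr; ring.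
move/eqP; rewrite mulf_eq0 subr_eq0 => /orP[/eqP|/eqP h]; first by left.
by right; rewrite -[RHS]addr0 -h; ring.
Qed.

Lemma generates_scalar L r : generates (r%:A : L) -> forall y : L, exists c, y = c%:A.
Proof. by move=> gr y; have [q <-] := gr y; exists q.[r]; rewrite horner_alg_in_alg. Qed.

(** Both fields are generated by 0, and the kernel of evaluation there is the same. *)
Lemma scalars_iso L L' : (forall y : L, exists c, y = c%:A) ->
  (forall y : L', exists c, y = c%:A) -> ext_iso L L'.
Proof.
have g0 (M : fieldExtType k) : (forall y : M, exists c, y = c%:A) -> generates (0%:A : M).
  by move=> sc y; have [c ->] := sc y; exists c%:P; rewrite horner_algC.
move=> /g0 gL /g0 gL'; apply: (ext_iso_of_kernel gL gL') => q.
have E (M : fieldExtType k) : horner_alg (0%:A : M) q = 0 <-> q.[0] = 0.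
  rewrite horner_alg_in_alg; split=> [/eqP|->]; last by rewrite scale0r.
  by rewrite scaler_eq0 oner_eq0 orbF => /eqP.
by rewrite !E.
Qed.

Lemma quad_irreducible a b :
  (forall r, r ^+ 2 + a * r + b != 0) -> irreducible_poly (quad a b).
Proof.
move=> nr; apply: cubic_irreducible => [|r]; first by rewrite size_quad.
by rewrite /root /quad !hornerE.
Qed.

(** If the polynomial has a root in k, both fields consist of scalars. Otherwise it is irreducible
    and generates the kernel of evaluation at either root. *)
Lemma quad_gen_iso L L' a b (x : L) (x' : L') :
  quad_gen a b x -> quad_gen a b x' -> ext_iso L L'.
Proof.
move=> [gx xr] [gx' xr'].
have [[r rr]|nr] := pselect (exists r, r ^+ 2 + a * r + b = 0).
  have sc (M : fieldExtType k) (y : M) : generates y ->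
      y ^+ 2 + a%:A * y + b%:A = 0 -> forall z : M, exists c, z = c%:A.
    move=> gy yr; suff [s ys] : exists s, y = s%:A.
      by rewrite ys in gy; exact: generates_scalar gy.
    have rM : (r%:A : M) ^+ 2 + a%:A * r%:A + b%:A = 0.
      have := congr1 (in_alg M) rr.
      by rewrite !(rmorphD, rmorphXn, rmorphM, rmorph0).
    have [->|->] := quad_factor rM yr; first by exists r.
    by exists (- a - r); rewrite scalerBl scaleNr.
  by apply: scalars_iso; [exact: sc gx xr|exact: sc gx' xr'].
have irr : irreducible_poly (quad a b).
  by apply: quad_irreducible => r; apply/eqP => rr; apply: nr; exists r.
have ker (M : fieldExtType k) (y : M) q : y ^+ 2 + a%:A * y + b%:A = 0 ->
    horner_alg y q = 0 <-> quad a b %| q.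
  move=> yr; split=> [q0|/dvdpP[d ->]]; last first.
    by rewrite rmorphM /= horner_quad yr mulr0.
  (* If [quad a b] did not divide q, a Bezout relation evaluated at y would read 0 = 1. *)
  apply: contraT; rewrite -irreducible_poly_coprime // => /Bezout_eq1_coprimepP [[u v] /= uv].
  have := congr1 (horner_alg y) uv.
  rewrite rmorphD !rmorphM /= horner_quad yr q0 !mulr0 addr0 rmorph1 => /esym/eqP.
  by rewrite oner_eq0.
by apply: (ext_iso_of_kernel gx gx') => q; rewrite !ker.
Qed.

Lemma exists_quad_gen a b : exists (L : fieldExtType k) (x : L), quad_gen a b x.
Proof.
have [[r rr]|nr] := pselect (exists r, r ^+ 2 + a * r + b = 0).
  exists k^o, (r%:A : k^o); split.
    by move=> y; exists (y : k)%:P; rewrite horner_algC; exact: mulr1.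
  have := congr1 (in_alg k^o) rr.
  by rewrite !(rmorphD, rmorphXn, rmorphM, rmorph0).
have irr : irreducible_poly (quad a b).
  by apply: quad_irreducible => r; apply/eqP => rr; apply: nr; exists r.
have [L _ [x xr full]] := irredp_FAdjoin irr.
by exists L, x; split; [exact/generatesP|rewrite -horner_quad; apply/eqP].
Qed.

Lemma deriv_quad a b : (quad a b)^`() = 'X *+ 2 + a%:P.
Proof. by rewrite /quad !derivE mulr1 addr0. Qed.

Lemma separable_quad a b : a ^+ 2 - 4%:R * b != 0 -> separable_poly (quad a b).
Proof.
(* With f = X^2 + a X + b, the identity f'^2 - 4 f = a^2 - 4 b is a Bezout relation in every
   characteristic. *)
move=> disc; rewrite unlock; apply/Bezout_coprimepP; exists (- 4%:R, (quad a b)^`()) => /=.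
rewrite (_ : _ + _ = (a ^+ 2 - 4%:R * b)%:P) ?polyC_eqp1 //.
by rewrite deriv_quad /quad rmorphB rmorphXn rmorphM rmorph_nat /=; ring.
Qed.

Lemma quad_gen_separable L a b (x : L) : a ^+ 2 - 4%:R * b != 0 ->
  quad_gen a b x -> separable 1 {:L} /\ (\dim {:L} <= 2)%N.
Proof.
move=> disc [/generatesP gx xr].
have f1 : map_poly (in_alg L) (quad a b) \is a polyOver 1%AS.
  by apply/polyOver1P; exists (quad a b).
have rf : root (map_poly (in_alg L) (quad a b)) x.
  by rewrite /root -[_.[x]]/(horner_alg x (quad a b)) horner_quad xr.
split.
  rewrite -gx -(adjoin_separable_eq 1%AS); apply/separable_elementP.
  by exists (map_poly (in_alg L) (quad a b)); rewrite separable_map separable_quad.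
rewrite -gx (dim_Fadjoin 1%AS) dimv1 muln1 -ltnS -size_minPoly.
have := dvdp_leq _ (minPoly_dvdp f1 rf).
by rewrite size_map_poly size_quad; apply; rewrite map_poly_eq0 -size_poly_eq0 size_quad.
Qed.

Lemma separable_quad_gen L : separable 1 {:L} -> (\dim {:L} <= 2)%N ->
  exists a b (x : L), a ^+ 2 - 4%:R * b != 0 /\ quad_gen a b x.
Proof.
move=> sepL dimL.
have [full|nfull] := pselect ({:L} = 1)%VS.
  (* X^2 + X has discriminant 1 in every characteristic, and 0 as a root. *)
  exists 1, 0, (0 : L); rewrite expr1n mulr0 subr0 oner_eq0; split=> //; split.
    by apply/generatesP; rewrite (Fadjoin0 1%AS) full.
  by rewrite scale0r mulr0 expr0n !addr0.
have [x x1] : exists x : L, x \notin 1%VS.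
  apply: contrapT => /forallNP nx; apply: nfull; apply/eqP; rewrite eqEsubv sub1v andbT.
  by apply/subvP => y _; apply: contraT => /nx.
have deg2 : (1 < adjoin_degree 1 x)%N.
  by rewrite ltn_neqAle eq_sym (adjoin_deg_eq1 1%AS) x1.
have dimx := dim_Fadjoin 1%AS x; rewrite dimv1 muln1 in dimx.
have full : <<1; x>>%VS = {:L}%VS.
  by apply/eqP; rewrite eqEdim subvf /= dimx (leq_trans dimL).
have deg : adjoin_degree 1 x = 2.
  by apply/eqP; rewrite eqn_leq deg2 -dimx full dimL.
have /polyOver1P [m mE] := minPolyOver 1%AS x.
have size_m : size m = 3 by rewrite -(size_map_poly (in_alg L)) -mE size_minPoly deg.
have mq : m = quad m`_1 m`_0.
  have : m \is monic by rewrite -(map_monic (in_alg L)) -mE monic_minPoly.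
  rewrite monicE lead_coefE size_m /= => /eqP m2.
  apply/polyP => i; rewrite /quad !(coefD, coefXn, coefCM, coefX, coefC).
  case: i => [|[|[|i]]] /=; rewrite ?(mulr0, mulr1, addr0, add0r) //.
  by rewrite nth_default // size_m.
move: (m`_1) (m`_0) mq => a b {size_m}mq; rewrite {}mq in mE.
exists a, b, x; have xr : x ^+ 2 + a%:A * x + b%:A = 0.
  by have := root_minPoly 1%AS x; rewrite mE -horner_quad => /rootP.
split; last by split=> //; exact/generatesP.
have := separable_root_der 1%AS x.
rewrite (separableP sepL) ?memvf //= mE deriv_map deriv_quad; apply: contraNneq => disc.
rewrite /root -[_.[x]]/(horner_alg x ('X *+ 2 + a%:P)) rmorphD rmorphMn /=.
rewrite horner_algX horner_algC.
have dL : a%:A ^+ 2 - 4%:R * b%:A = 0 :> L.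
  have := congr1 (in_alg L) disc.
  by rewrite rmorphB rmorphXn rmorphM rmorph_nat rmorph0.
(* (2x + a)^2 is the discriminant plus 4 times the equation of x. Were it zero, the derivative of
   the minimal polynomial would vanish at x, against separability. *)
suff : (x *+ 2 + a%:A) ^+ 2 = 0 by move/eqP; rewrite expf_eq0.
by rewrite -[RHS]dL -[RHS]addr0 -(mulr0 4%:R) -xr; ring.
Qed.

(** The formulas give the coefficients of the polynomial whose roots are the images of those of X^2
    + a X + b under z -> u + v z. For x outside k, (1, x) is a basis and x' = u + v x. *)
Lemma quad_gen_affine L a b a' b' (x x' : L) :
  a ^+ 2 - 4%:R * b != 0 -> a' ^+ 2 - 4%:R * b' != 0 ->
  quad_gen a b x -> quad_gen a' b' x' ->
  exists u v, [/\ v != 0, a' = v * a - 2%:R * u & b' = u ^+ 2 - u * v * a + v ^+ 2 * b].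
Proof.
move=> disc disc' [gx xr] [gx' xr'].
have injA c d : c%:A = d%:A :> L -> c = d by move/(fmorph_inj (in_alg L)).
have [[r xE]|nx] := pselect (exists r, x = r%:A).
  (* u and v come from sending r to r' and -a - r to -a' - r'. *)
  rewrite xE in gx xr; have [r' xE'] := generates_scalar gx x'.
  rewrite xE' in xr'.
  have rr : r ^+ 2 + a * r + b = 0.
    by apply: injA; rewrite -in_algE !(rmorphD, rmorphXn, rmorphM) /= scale0r.
  have rr' : r' ^+ 2 + a' * r' + b' = 0.
    by apply: injA; rewrite -in_algE !(rmorphD, rmorphXn, rmorphM) /= scale0r.
  (* 2r + a is the difference of the two roots; its square is the discriminant. *)
  have d1 : 2%:R * r + a != 0.
    apply: contraNneq disc => E.
    suff -> : a ^+ 2 - 4%:R * b = (2%:R * r + a) ^+ 2 - 4%:R * (r ^+ 2 + a * r + b).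
      by rewrite E rr mulr0 expr0n subr0.
    by ring.
  have d1' : 2%:R * r' + a' != 0.
    apply: contraNneq disc' => E.
    suff -> : a' ^+ 2 - 4%:R * b' = (2%:R * r' + a') ^+ 2 - 4%:R * (r' ^+ 2 + a' * r' + b').
      by rewrite E rr' mulr0 expr0n subr0.
    by ring.
  have bE : b = - (r ^+ 2 + a * r) by rewrite -[LHS]subr0 -rr; ring.
  have bE' : b' = - (r' ^+ 2 + a' * r') by rewrite -[LHS]subr0 -rr'; ring.
  pose v := (2%:R * r' + a') / (2%:R * r + a).
  exists (r' - v * r), v; split; first by rewrite mulf_neq0 // invr_eq0.
    by rewrite /v; field.
  by rewrite bE bE' /v; field.
have lin y : exists u v, y = u%:A + v%:A * x.
  have [q <-] := gx y; elim/poly_ind: q => [|q c [u [v IH]]].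
    by exists 0, 0; rewrite rmorph0 scale0r mul0r addr0.
  (* Horner step: (u + v x) x + c, reduced by x^2 = - a x - b. *)
  exists (c - v * b), (u - v * a).
  rewrite rmorphD rmorphM /= horner_algC horner_algX IH -!in_algE !rmorphB !rmorphM /=.
  by rewrite -[RHS]addr0 -(mulr0 v%:A) -xr; ring.
have li c d : c%:A + d%:A * x = 0 -> c = 0 /\ d = 0.
  move=> E; have d0 : d = 0.
    apply: contrapT => /eqP d0; apply: nx; exists (- c / d).
    have dx : d *: x = - c%:A by apply/eqP; rewrite -addr_eq0 -(mulr_algl d x) addrC E.
    by rewrite -[LHS](scalerK d0) dx scalerN scalerA mulNr mulrC scaleNr.
  split=> //; move: E; rewrite d0 scale0r mul0r addr0 => /eqP.
  by rewrite scaler_eq0 oner_eq0 orbF => /eqP.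
have [u [v xE']] := lin x'.
have v0 : v != 0.
  apply: contra_notN nx => /eqP v0; move: xE'; rewrite v0 scale0r mul0r addr0 => xE'.
  by rewrite xE' in gx'; exact: generates_scalar gx' x.
have [E0 E1] : u ^+ 2 - v ^+ 2 * b + a' * u + b' = 0 /\
    2%:R * u * v - v ^+ 2 * a + a' * v = 0.
  apply: li; rewrite -!in_algE !(rmorphD, rmorphB, rmorphN, rmorphXn, rmorphM, rmorph_nat) /=.
  by rewrite -[RHS]xr' xE' -[RHS]subr0 -[in RHS](mulr0 (v%:A ^+ 2)) -xr; ring.
have aE : a' = v * a - 2%:R * u.
  by apply: (mulIf v0); rewrite -[LHS]subr0 -E1; ring.
exists u, v; split=> //.
by rewrite -[LHS]subr0 -E0 aE; ring.
Qed.

End Quadratic.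

(** * Orbits and root fields *)

Section RootFields.
Variable k : fieldType.
Implicit Types (L : fieldExtType k) (a b u v : k) (g : triples k) (w : pairs k).

(** Eigenvalues being negated roots, z -> u + v z on roots is C -> v C - u. The third factor
    performs this, and c, with columns e_0 and (v C - u) e_0, returns the result to companion
    form. *)
Lemma companion_affine a b u v : v != 0 -> exists2 g, GL2_3 g &
  act_pairs g (1%:M, companion a b)
  = (1%:M, companion (v * a - 2%:R * u) (u ^+ 2 - u * v * a + v ^+ 2 * b)).
Proof.
move=> v0; pose c : 'M[k]_2 := mx22 1 (- u) 0 v.
have cU : c \in unitmx by rewrite unitmxE unitfE !mx2E /= mulr0 subr0 mul1r.
exists (invmx c, c^T, mx22 1 0 (- u) v).
  split; rewrite /= ?unitmx_inv ?unitmx_tr //.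
  by rewrite unitmxE unitfE !mx2E /= mul0r subr0 mul1r.
rewrite /act_pairs trmxK mulmx1 mulVmx // -mulmxA; congr (_, _).
  by rewrite !mxE /= scale1r scale0r addr0.
apply: (row_full_inj (A := c)); rewrite ?row_full_unit //.
rewrite mulmxDr -!scalemxAr mulmx1 mulKVmx //.
by apply: eq_mx22; rewrite !mx2E /=; ring.
Qed.

(* Also true for vanishing denominators, the ratios being then 0. *)
Lemma ratio_mobius L (K : {subfield L}) (c : 'M[k]_2) (s t : L) :
  s / t \in K ->
  (s * (c 0 0)%:A + t * (c 1 0)%:A) / (s * (c 0 1)%:A + t * (c 1 1)%:A) \in K.
Proof.
have cK d : d%:A \in K by rewrite rpredZ // mem1v.
move=> stK; have [->|t0] := eqVneq t 0.
  rewrite !mul0r !addr0; have [->|s0] := eqVneq s 0; first by rewrite !mul0r rpred0.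
  by rewrite -mulf_div divff // mul1r rpred_div.
have -> : s = s / t * t by rewrite divfK.
move: (s / t) stK => z zK.
rewrite -![z * t * _]mulrA ![t * _%:A]mulrC !mulrA -!mulrDl -mulf_div divff // mulr1.
by rewrite rpred_div // rpredD // rpredM.
Qed.

Lemma form_act (R : comNzRingType) (f : {rmorphism k -> R}) g w s t :
  form (map_mx f (act_pairs g w).1) (map_mx f (act_pairs g w).2) s t
  = f (\det g.1.1 * \det g.1.2) * form (map_mx f w.1) (map_mx f w.2)
     (s * f (g.2 0 0) + t * f (g.2 1 0)) (s * f (g.2 0 1) + t * f (g.2 1 1)).
Proof.
case: g w => [[g1 g2] g3] [A B] /=.
pose s' := s * f (g3 0 0) + t * f (g3 1 0); pose t' := s * f (g3 0 1) + t * f (g3 1 1).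
rewrite -/s' -/t'.
have E : s *: map_mx f (g3 0 0 *: (g1 *m A *m g2^T) + g3 0 1 *: (g1 *m B *m g2^T))
    + t *: map_mx f (g3 1 0 *: (g1 *m A *m g2^T) + g3 1 1 *: (g1 *m B *m g2^T))
    = map_mx f g1 *m (s' *: map_mx f A + t' *: map_mx f B) *m map_mx f g2^T.
  rewrite mulmxDr mulmxDl -!scalemxAr -!scalemxAl -!map_mxM /s' /t'.
  move: (g1 *m A *m g2^T) (g1 *m B *m g2^T) => A' B'.
  by apply/matrixP => i j; rewrite !mxE !rmorphD !rmorphM /=; ring.
by rewrite /form E !det_mulmx !det_map_mx det_tr rmorphM mulrAC.
Qed.

(** The roots move by a projective transformation with coefficients in k; the old ratios are
    recovered from the new ones by another, so the new ones generate L too. *)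
Lemma generated_by_roots_act L g w : GL2_3 g ->
  generated_by_roots w L -> generated_by_roots (act_pairs g w) L.
Proof.
move=> [g1 g2 g3] [p [q [pq Fp Fq full]]].
(* [m] is multiplication of row vectors by the adjugate of [c]. *)
pose c := g.2; pose m (s : L * L) : L * L :=
  (s.1 * (c 1 1)%:A - s.2 * (c 1 0)%:A, s.2 * (c 0 0)%:A - s.1 * (c 0 1)%:A).
have d0 : (\det c)%:A != 0 :> L by rewrite scaler_eq0 oner_eq0 orbF -unitfE -unitmxE.
have dE : (\det c)%:A = (c 0 0)%:A * (c 1 1)%:A - (c 0 1)%:A * (c 1 0)%:A :> L.
  by rewrite det_mx22 -!in_algE rmorphB !rmorphM.
have m1 s : (m s).1 * (c 0 0)%:A + (m s).2 * (c 1 0)%:A = (\det c)%:A * s.1.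
  by rewrite dE /m /=; ring.
have m2 s : (m s).1 * (c 0 1)%:A + (m s).2 * (c 1 1)%:A = (\det c)%:A * s.2.
  by rewrite dE /m /=; ring.
have mF s : form (map_mx (in_alg L) w.1) (map_mx (in_alg L) w.2) s.1 s.2 = 0 ->
    form (map_mx (in_alg L) (act_pairs g w).1) (map_mx (in_alg L) (act_pairs g w).2)
      (m s).1 (m s).2 = 0.
  move=> Fs; rewrite form_act /= -/c m1 m2.
  have -> A B : form A B ((\det c)%:A * s.1) ((\det c)%:A * s.2)
      = (\det c)%:A ^+ 2 * form A B s.1 s.2 :> L by rewrite !formE; ring.
  by rewrite Fs !mulr0.
exists (m p), (m q); split; [|exact: mF|exact: mF|].
  have -> : (m p).1 * (m q).2 - (m p).2 * (m q).1 = (\det c)%:A * (p.1 * q.2 - p.2 * q.1).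
    by rewrite dE /m /=; ring.
  exact: mulf_neq0.
apply/eqP; rewrite eqEsubv subvf /= -full.
set rs := [:: (m p).1 / _; _].
have back s : (m s).1 / (m s).2 \in <<1 & rs>>%VS -> s.1 / s.2 \in <<1 & rs>>%VS.
  move=> sK; have -> : s.1 / s.2 = ((\det c)%:A * s.1) / ((\det c)%:A * s.2).
    by rewrite -mulf_div divff // mul1r.
  rewrite -m1 -m2.
  exact: (@ratio_mobius _ <<1 & rs>>%AS).
apply/(@Fadjoin_seqP _ _ 1%AS _ <<1 & rs>>%AS); split; first exact: subv_adjoin_seq.
move=> z; rewrite !inE => /orP[] /eqP->; apply: back; apply: seqv_sub_adjoin.
  by rewrite inE eqxx.
by rewrite !inE eqxx orbT.
Qed.

Lemma form_companion L a b (s t : L) :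
  form (map_mx (in_alg L) 1%:M) (map_mx (in_alg L) (companion a b)) s t
  = s ^+ 2 + a%:A * (s * t) + b%:A * t ^+ 2.
Proof.
rewrite form_map det1 rmorph1 mul1r.
congr (_ + in_alg L _ * _ + in_alg L _ * _); last by rewrite !mx2E /=; ring.
by rewrite /polar_det !mxE /=; ring.
Qed.

(** F has leading coefficient 1, so neither root is at infinity, and the second root - a - x lies in
    k(x). *)
Lemma generated_by_roots_companion L a b : a ^+ 2 - 4%:R * b != 0 ->
  generated_by_roots (1%:M, companion a b) L <-> exists x : L, quad_gen a b x.
Proof.
move=> disc; split=> [[p [q []]]|[x [/generatesP full xr]]].
  rewrite /= !form_companion => pq Fp Fq full.
  have fin (s : L * L) : s != 0 -> s.1 ^+ 2 + a%:A * (s.1 * s.2) + b%:A * s.2 ^+ 2 = 0 ->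
      s.2 != 0.
    case: s => s t /= st0 Fs; apply: contraNneq st0 => t0; move: Fs.
    rewrite t0 !(mulr0, expr0n, addr0) => /eqP.
    by rewrite expf_eq0 => /eqP ->.
  have p0 : p.2 != 0.
    apply: fin Fp; apply: contraNneq pq => ->; by rewrite !mul0r subr0.
  have q0 : q.2 != 0.
    apply: fin Fq; apply: contraNneq pq => ->; by rewrite !mulr0 subr0.
  have rt (s : L * L) : s.2 != 0 -> s.1 ^+ 2 + a%:A * (s.1 * s.2) + b%:A * s.2 ^+ 2 = 0 ->
      (s.1 / s.2) ^+ 2 + a%:A * (s.1 / s.2) + b%:A = 0.
    by move=> s0 Fs; rewrite -[RHS](mul0r (s.2 ^- 2)) -Fs; field.
  exists (p.1 / p.2); split; last exact: rt.
  apply/generatesP/eqP; rewrite eqEsubv subvf /= -full.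
  apply/(@Fadjoin_seqP _ _ 1%AS _ <<1; p.1 / p.2>>%AS); split; first exact: subv_adjoin.
  have pK : p.1 / p.2 \in <<1; p.1 / p.2>>%VS by exact: memv_adjoin.
  move=> z; rewrite !inE => /orP[] /eqP-> //.
  have [->//|->] := quad_factor (rt _ p0 Fp) (rt _ q0 Fq).
  by rewrite rpredB // rpredN rpredZ // mem1v.
exists (x, 1), (- a%:A - x, 1); rewrite /= !form_companion; split.
(* The two points differ since (2x + a)^2 is the discriminant. *)
- rewrite mulr1 mul1r; apply: contraNneq disc => E.
  apply/eqP/(fmorph_inj (in_alg L)).
  rewrite rmorph0 rmorphB rmorphXn rmorphM rmorph_nat /=.
  suff -> : a%:A ^+ 2 - 4%:R * b%:A = (x - (- a%:A - x)) ^+ 2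
      - 4%:R * (x ^+ 2 + a%:A * x + b%:A) :> L by rewrite E xr mulr0 expr0n subr0.
  by ring.
- by rewrite mulr1 expr1n mulr1.
- by rewrite -xr; ring.
apply/eqP; rewrite eqEsubv subvf /= -full adjoin_cons adjoin_seq1 divr1.
exact: subv_adjoin.
Qed.

(** Every pair in the orbit has the root fields of the normal form, and those are the fields
    isomorphic to L. *)
Lemma root_field_classE g w a b L (x : L) :
  GL2_3 g -> act_pairs g w = (1%:M, companion a b) -> a ^+ 2 - 4%:R * b != 0 ->
  quad_gen a b x -> root_field_class (orbit_of (@act_pairs k) w) = ext_iso L.
Proof.
move=> gG gw disc xL; apply/funext => L'; apply/propext.
have orbE : orbit_of (@act_pairs k) w = orbit_of (@act_pairs k) (1%:M, companion a b).
  by rewrite -gw orbit_of_act //; exact: act_pairs_is_act.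
split=> [[w' ww' w'L']|[f fbij]].
  have [h hG hw'] : orbit_of (@act_pairs k) w' (1%:M, companion a b).
    have [h hG <-] := ww'; rewrite orbit_of_act // ?orbE; last exact: act_pairs_is_act.
    exact/orbit_of_refl/act_pairs_is_act.
  have := generated_by_roots_act hG w'L'; rewrite hw'.
  by move=> /(generated_by_roots_companion _ disc) [x' x'L']; exact: quad_gen_iso xL x'L'.
exists (1%:M, companion a b); first by exists g.
apply/(generated_by_roots_companion _ disc); have [gx xr] := xL.
exists (f x); split; first exact: generates_iso.
by rewrite -!(rmorph_alg f) -rmorphXn -rmorphM -!rmorphD xr rmorph0.
Qed.

Lemma ext_iso_refl L : ext_iso L L.
Proof. by exists (idfun : {lrmorphism L -> L}); exists idfun. Qed.

Lemma bij_Ex2 : bij_onto (orbit_space (@act_pairs k) (@pairs_ss k))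
  (@Ex2 k) (@root_field_class k).
Proof.
have actP := act_pairs_is_act k.
split=> [_ [w w_ss <-]|_ _ [w w_ss <-] [w' w'_ss <-] eqC|C [L [sepL dimL ->]]].
- have [g [a [b [gG gw disc]]]] := normal_form w_ss.
  have [L [x xL]] := exists_quad_gen a b.
  have [sepL dimL] := quad_gen_separable disc xL.
  by exists L; split=> //; exact: root_field_classE gG gw disc xL.
- have [g [a [b [gG gw disc]]]] := normal_form w_ss.
  have [g' [a' [b' [gG' gw' disc']]]] := normal_form w'_ss.
  have [L [x xL]] := exists_quad_gen a b.
  have [L' [x' xL']] := exists_quad_gen a' b'.
  (* L lies in the common class. The isomorphism brings x' into L, where the two generators can be
     compared. *)
  have : ext_iso L' L.
    rewrite -(root_field_classE gG' gw' disc' xL') -eqC.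
    by rewrite (root_field_classE gG gw disc xL); exact: ext_iso_refl.
  move=> [f fbij]; have [gx' xr'] := xL'.
  have fx' : quad_gen a' b' (f x').
    split; first exact: generates_iso.
    by rewrite -!(rmorph_alg f) -rmorphXn -rmorphM -!rmorphD xr' rmorph0.
  have [u [v [v0 aE bE]]] := quad_gen_affine disc disc' xL fx'.
  have [h hG hC] := companion_affine a b u v0.
  rewrite -(orbit_of_act w actP gG) gw -(orbit_of_act w' actP gG') gw'.
  by rewrite aE bE -hC orbit_of_act.
have [a [b [x [disc xL]]]] := separable_quad_gen sepL dimL.
have one_act := proj1 actP (1%:M, companion a b).
have oneG : GL2_3 (one_triple k) by split; exact: unitmx1.
exists (orbit_of (@act_pairs k) (1%:M, companion a b)).
  by exists (1%:M, companion a b) => //; rewrite /pairs_ss /= P1_companion.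
exact: root_field_classE oneG one_act disc xL.
Qed.

End RootFields.

Theorem proposition11p3 (k : fieldType) :
  [/\ set_bij (orbit_space (@act_a k) (@Ua k))
              (orbit_space (@act_pairs k) (@pairs_ss k))
              (fun O => @proj_a k @` O),
      set_bij (orbit_space (@act_b k) (@Ub k))
              (orbit_space (@act_pairs k) (@pairs_ss k))
              (fun O => @proj_b k @` O)
    & bij_onto (orbit_space (@act_pairs k) (@pairs_ss k))
               (@Ex2 k) (@root_field_class k)].
Proof. by split; [exact: bij_a|exact: bij_b|exact: bij_Ex2]. Qed.
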